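(* Let $\epsilon=(\epsilon_1,\epsilon_2)\in[0,\infty)^2$ and $1\le p\le\infty$. Let $\epsilon^*=(\epsilon_1^*,\epsilon_2^* )$ with $\epsilon_1^*=\epsilon_2^*=(1+\epsilon_1)(1+\epsilon_2)-1=\epsilon_1+\epsilon_2+\epsilon_1\epsilon_2$. Let $X,Y,Z$ be compact pmm-spaces. Then \[ \mathsf{sPGW}_{\epsilon^*,p}(X,Z)\le(1+\epsilon_2)^{2/p}\,\mathsf{sPGW}_{\epsilon,p}(X,Y)+(1+\epsilon_1)^{2/p}\,\mathsf{sPGW}_{\epsilon,p}(Y,Z), \] where $(1+\epsilon_i)^{2/\infty}=1$.
   Context: A pmm-space is a triple $(X,d_X,\mu_X)$ with $(X,d_X)$ a complete separable metric space and $\mu_X$ a Borel probability measure; compact means $(X,d_X)$ compact. For a measure $\pi$ on $X\times Y$, $\pi_X,\pi_Y$ are its marginals. For $p<\infty$, $\|d_X-d_Y\|_{L^p(\pi\otimes\pi)}=\left(\iint|d_X(x,x')-d_Y(y,y')|^p\,d\pi(x,y)\,d\pi(x',y')\right)^{1/p}$; for $p=\infty$ it is the $\pi\otimes\pi$-essential supremum. For $\epsilon=(\epsilon_1,\epsilon_2)$, $\mathcal{S}_\epsilon(\mu_X,\mu_Y)$ is the set of Borel probability measures $\pi$ on $X\times Y$ with $\pi_X,\mu_X$ mutually absolutely continuous and $\|d\pi_X/d\mu_X\|_{L^\infty(\mu_X)},\|d\mu_X/d\pi_X\|_{L^\infty(\pi_X)}\le1+\epsilon_1$, and $\pi_Y,\mu_Y$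 mutually absolutely continuous with $\|d\pi_Y/d\mu_Y\|_{L^\infty(\mu_Y)},\|d\mu_Y/d\pi_Y\|_{L^\infty(\pi_Y)}\le1+\epsilon_2$. $\mathsf{sPGW}_{\epsilon,p}(X,Y)=\inf_{\pi\in\mathcal{S}_\epsilon(\mu_X,\mu_Y)}\|d_X-d_Y\|_{L^p(\pi\otimes\pi)}$. *)

(* Defs.v *)
From HB Require Import structures.
From mathcomp Require Import all_boot all_order all_algebra.
From mathcomp Require Import all_classical all_reals all_analysis.
From mathcomp Require Import ess_sup_inf.
Set Implicit Arguments.
Unset Strict Implicit.
Unset Printing Implicit Defensive.
Import Order.TTheory GRing.Theory Num.Theory.
Import numFieldNormedType.Exports.
Local Open Scope classical_set_scope.
Local Open Scope ring_scope.

Definition is_metric (R : realType) (T : Type) (dist : T -> T -> R) : Prop :=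
  [/\ (forall x y, 0 <= dist x y),
      (forall x y, dist x y = 0 <-> x = y),
      (forall x y, dist x y = dist y x) &
      (forall x y z, dist x z <= dist x y + dist y z)].

Definition metric_open (R : realType) (T : Type) (dist : T -> T -> R)
  (A : set T) : Prop :=
  forall x, A x -> exists2 r : R, 0 < r & [set y | dist x y < r] `<=` A.

Definition metric_cvg (R : realType) (T : Type) (dist : T -> T -> R)
  (u : nat -> T) (x : T) : Prop :=
  forall e : R, 0 < e -> exists N : nat, forall n, (N <= n)%N -> dist (u n) x < e.

Definition metric_cauchy (R : realType) (T : Type) (dist : T -> T -> R)
  (u : nat -> T) : Prop :=
  forall e : R, 0 < e -> exists N : nat,
    forall m n, (N <= m)%N -> (N <= n)%N -> dist (u m) (u n) < e.

Definition metric_complete (R : realType) (T : Type) (dist : T -> T -> R) : Prop :=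
  forall u : nat -> T, metric_cauchy dist u -> exists x, metric_cvg dist u x.

Definition metric_separable (R : realType) (T : Type) (dist : T -> T -> R) : Prop :=
  exists D : set T, countable D /\
    forall x (e : R), 0 < e -> exists2 y, D y & dist x y < e.

Definition metric_compact (R : realType) (T : Type) (dist : T -> T -> R) : Prop :=
  forall u : nat -> T, exists phi : nat -> nat,
    (forall n m, (n < m)%N -> (phi n < phi m)%N) /\
    exists x, metric_cvg dist (u \o phi) x.

Definition borel_structure (R : realType) (d : measure_display)
  (T : measurableType d) (dist : T -> T -> R) : Prop :=
  @measurable d T = <<s metric_open dist >>.

(* (T, dist, mu) is a compact pmm-space: (T, dist) is a complete separable
   (and compact) metric space, and the σ-algebra of T is its Borel σ-algebra,
   so that any [mu : probability T R] is a Borel probability measure. *)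
Definition compact_pmm_space (R : realType) (d : measure_display)
  (T : measurableType d) (dist : T -> T -> R) : Prop :=
  [/\ is_metric dist, metric_complete dist, metric_separable dist,
      metric_compact dist & borel_structure dist].

Local Open Scope ereal_scope.

Definition is_RN_derivative (R : realType) (d : measure_display)
  (T : measurableType d) (nu mu : {measure set T -> \bar R}) (f : T -> R) : Prop :=
  [/\ measurable_fun setT f, (forall x, (0 <= f x)%R) &
      forall A, measurable A -> nu A = \int[mu]_(x in A) (f x)%:E].

Definition RN_bounded (R : realType) (d : measure_display)
  (T : measurableType d) (nu mu : {measure set T -> \bar R}) (c : R) : Prop :=
  exists f : T -> R, is_RN_derivative nu mu f /\
    ess_sup mu (fun x => (`|f x|)%:E) <= c%:E.

Definition mutually_bounded (R : realType) (d : measure_display)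
  (T : measurableType d) (nu mu : {measure set T -> \bar R}) (c : R) : Prop :=
  [/\ nu `<< mu, mu `<< nu, RN_bounded nu mu c & RN_bounded mu nu c].

Definition marginal1 (R : realType) (dx dy : measure_display)
  (X : measurableType dx) (Y : measurableType dy)
  (pi : {measure set (X * Y)%type -> \bar R}) : {measure set X -> \bar R}.
Proof. refine (pushforward pi fst); exact: measurable_fst. Defined.

Definition marginal2 (R : realType) (dx dy : measure_display)
  (X : measurableType dx) (Y : measurableType dy)
  (pi : {measure set (X * Y)%type -> \bar R}) : {measure set Y -> \bar R}.
Proof. refine (pushforward pi snd); exact: measurable_snd. Defined.

Definition S_eps (R : realType) (dx dy : measure_display)
  (X : measurableType dx) (Y : measurableType dy) (e1 e2 : R)
  (muX : probability X R) (muY : probability Y R)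
  (pi : probability (X * Y)%type R) : Prop :=
  mutually_bounded (marginal1 pi) muX (1 + e1)%R /\
  mutually_bounded (marginal2 pi) muY (1 + e2)%R.

(* ‖d_X - d_Y‖_{L^p(pi ⊗ pi)} for p ∈ [1, ∞] (p = -oo is junk) ;
   a point of (X × Y) × (X × Y) is z = ((x, y), (x', y')). *)
Definition distortion (R : realType) (dx dy : measure_display)
  (X : measurableType dx) (Y : measurableType dy)
  (distX : X -> X -> R) (distY : Y -> Y -> R) (p : \bar R)
  (pi : probability (X * Y)%type R) : \bar R :=
  match p with
  | r%:E => poweR (\int[pi \x pi]_z
              ((`|distX z.1.1 z.2.1 - distY z.1.2 z.2.2|) `^ r)%:E) r^-1
  | +oo => ess_sup (pi \x pi)
              (fun z => (`|distX z.1.1 z.2.1 - distY z.1.2 z.2.2|)%:E)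
  | -oo => 0
  end.

Definition sPGW (R : realType) (dx dy : measure_display)
  (X : measurableType dx) (Y : measurableType dy) (e1 e2 : R) (p : \bar R)
  (distX : X -> X -> R) (distY : Y -> Y -> R)
  (muX : probability X R) (muY : probability Y R) : \bar R :=
  ereal_inf [set v | exists pi : probability (X * Y)%type R,
                       S_eps e1 e2 muX muY pi /\ v = distortion distX distY p pi].

Definition coef (R : realType) (e : R) (p : \bar R) : R :=
  match p with
  | r%:E => ((1 + e) `^ (2 / r))%R
  | _ => 1%R
  end.

(* Main.v *)
(* Given pi coupling X and Y and sigma coupling Y and Z, an exact gluing along
   Y would require disintegrations.  Because sPGW is an infimum, gluing up to
   a small error suffices: cut Y into countably many Borel cells P_n of small
   diameter, and put on (X * Y) * (Y * Z) the measure
     sum_n muY(P_n) / (pi_Y(P_n) sigma_Y(P_n)) *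
             (pi \x sigma) restricted to y, y' \in P_n,
   under which x and z are conditionally independent given the cell.  Each cell
   has mass muY(P_n), so the (X * Y)-marginal is within the factor 1 + e2 of pi
   and the (Y * Z)-marginal within the factor 1 + e1 of sigma, while the two
   Y-coordinates almost surely differ by at most the cell diameter.  The bounds
   for the (X * Z)-marginal follow by composition and from Minkowski's
   inequality. *)
Require Import Defs.
From HB Require Import structures.
From mathcomp Require Import all_boot all_order all_algebra.
From mathcomp Require Import all_classical all_reals all_analysis.
From mathcomp Require Import ess_sup_inf measurable_realfun.
From mathcomp Require Import ring lra.
Set Implicit Arguments.
Unset Strict Implicit.
Unset Printing Implicit Defensive.
Import Order.TTheory GRing.Theory Num.Theory.
Local Open Scope ring_scope.
Local Open Scope classical_set_scope.
Local Open Scope ereal_scope.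

(** * Bounded densities and setwise inequalities *)

Section bundle_measure.
Context (R : realType) (d : measure_display) (T : measurableType d).
Variable mu : {measure set T -> \bar R}.

(** Copies of [mu], convertible to it, that carry a proof as an extra argument: the structures of
    finite measure and of probability can then be attached to a measure not built with them. *)
Definition as_finite (_ : fin_num_fun mu) : set T -> \bar R := mu.
Definition as_probability (_ : mu setT = 1) : set T -> \bar R := mu.

Variables (finmu : fin_num_fun mu) (mu1 : mu setT = 1).

HB.instance Definition _ := Measure.on (as_finite finmu).
HB.instance Definition _ :=
  Measure_isFinite.Build _ _ _ (as_finite finmu) finmu.
HB.instance Definition _ := Measure.on (as_probability mu1).
HB.instance Definition _ :=
  Measure_isProbability.Build _ _ _ (as_probability mu1) mu1.

End bundle_measure.

Definition image_probability (R : realType) (dA dC : measure_display)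
    (A : measurableType dA) (C : measurableType dC) (m : probability A R)
    (g : A -> C) (mg : measurable_fun setT g) : probability C R :=
  distribution m
    (HB.pack_for {mfun A >-> C} g (isMeasurableFun.Build _ _ _ _ g mg)).

(** The inequality makes [nu] absolutely continuous, so a density [f] exists. On the set where [f]
    exceeds [c], the integral of [f - c] is at most 0, so this set is null. *)
Lemma RN_bounded_of_le (R : realType) (d : measure_display)
    (T : measurableType d) (nu mu : {measure set T -> \bar R}) (c : R) :
  fin_num_fun nu -> fin_num_fun mu -> (0 <= c)%R ->
  (forall A, measurable A -> nu A <= c%:E * mu A) -> RN_bounded nu mu c.
Proof.
move=> finnu finmu c0 numu.
pose nu' : {finite_measure set T -> \bar R} := as_finite finnu.
pose mu' : {finite_measure set T -> \bar R} := as_finite finmu.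
have dom : nu' `<< mu'.
  apply/null_content_dominatesP => A mA muA0; apply/eqP.
  by rewrite eq_le measure_ge0 andbT (le_trans (numu A mA))// [mu A]muA0 mule0.
have [f [f0 ffin fint fE]] := @radon_nikodym_sigma_finite _ _ _ mu' nu' dom.
have mf : measurable_fun setT f by case/integrableP : fint.
exists (fine \o f); split.
  split.
  - exact: measurableT_comp.
  - by move=> x; rewrite /= fine_ge0.
  - move=> A mA; rewrite [LHS]fE//; apply: eq_integral => x _.
    by rewrite /= fineK.
rewrite (_ : (fun x => _) = f); last first.
  by apply/funext => x /=; rewrite ger0_norm ?fine_ge0// fineK.
apply/ess_supP/ae_le_measureP => //.
(* [N] is the set where the density exceeds [c]. *)
set N := _ @^-1` _.
have mN : measurable N by rewrite -[N]setTI; apply: mf => //; exact: emeasurable_itv.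
have mfc : measurable_fun N (fun x => f x - c%:E).
  by apply: emeasurable_funB => //; exact: measurable_funTS.
have fc0 x : N x -> 0 <= f x - c%:E.
  by move=> Nx; rewrite sube_ge0//; move: Nx; rewrite /N /= in_itv/= andbT => /ltW.
have int0 : \int[mu]_(x in N) (f x - c%:E) = 0.
  apply/eqP; rewrite eq_le integral_ge0 ?andbT; last by move=> x; exact: fc0.
  (* Finiteness of [c * mu N] allows it to be added to both sides; the left side becomes the
     integral of [f] over [N], that is [nu N]. *)
  have muNfin : c%:E * mu N \is a fin_num by rewrite fin_numM// finmu.
  rewrite -(leeD2rE _ _ muNfin) add0e (le_trans _ (numu N mN))//.
  rewrite [leRHS]fE// -[X in _ + X <= _]integral_cst// -ge0_integralD//.
  by under eq_integral do rewrite subeK//.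
have := (ae_eq_integral_abs mu mN mfc).1.
rewrite (eq_integral (fun x => f x - c%:E)); last first.
  by move=> x; rewrite inE => Nx; rewrite gee0_abs// fc0.
move=> /(_ int0) fc.
(* Almost everywhere on [N] the function [f - c] vanishes, whereas it is positive at every point of
   [N]. *)
have : mu.-negligible N.
  apply: negligibleS fc => x Nx /(_ Nx) /eqP.
  rewrite sube_eq// ?add0e.
  by move/eqP => fxc; move: Nx; rewrite /N/= fxc in_itv/= ltxx.
by move/negligibleP; apply.
Qed.

Lemma le_of_RN_bounded (R : realType) (d : measure_display)
    (T : measurableType d) (nu mu : {measure set T -> \bar R}) (c : R) :
  (0 <= c)%R -> RN_bounded nu mu c ->
  forall A, measurable A -> nu A <= c%:E * mu A.
Proof.
move=> c0 [f [[mf f0 fE] /ess_supP fc]] A mA.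
rewrite fE// -integral_cst//; apply: ae_ge0_le_integral => //.
- by move=> x _; rewrite lee_fin.
- by apply/measurable_EFinP; exact: measurable_funTS.
- by apply: filterS fc => x + _; rewrite ger0_norm.
Qed.

(** * Borel structure of a separable metric space *)

(** An injection of the dense set into the naturals is inverted by choice; indices outside its image
    get the default point [x0]. *)
Lemma metric_separable_seq (R : realType) (T : Type) (dist : T -> T -> R) (x0 : T) :
  metric_separable dist ->
  exists s : nat -> T, forall x (e : R), (0 < e)%R -> exists n, (dist x (s n) < e)%R.
Proof.
move=> [D [/countable_injP[f finj] Ddense]].
pose s n := if pselect (exists x, D x /\ f x = n) is left h then projT1 (cid h) else x0.
exists s => x e e0; have [y Dy xye] := Ddense x e e0.
exists (f y); rewrite /s; case: pselect => [h|[]]; last by exists y.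
case: (cid h) => z /= [Dz fzy].
by rewrite (finj z y)// ?inE.
Qed.

Section borel_metric.
Context (R : realType) (d : measure_display) (T : measurableType d).
Variables (dist : T -> T -> R).
Hypothesis distP : is_metric dist.
Hypothesis borelT : borel_structure dist.

Lemma measurable_metric_ball x (r : R) : measurable [set y | (dist y x < r)%R].
Proof.
have [d0 d00 dC dT] := distP.
rewrite borelT; apply: sub_sigma_algebra => y /= yxr.
exists (r - dist y x)%R; first by rewrite subr_gt0.
move=> z /= yz; rewrite (le_lt_trans (dT z y x))// dC.
by rewrite -ltrBrDr.
Qed.

(** Measurability is for the product of the Borel structures, where open sets of the product are not
    directly available. With a dense sequence [s], [dist x y < r] holds iff
    [dist x (s n) + dist y (s n) < r] for some [n], a countable union of measurable conditions. *)
Lemma measurable_dist : metric_separable dist ->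
  measurable_fun setT (fun z : T * T => dist z.1 z.2).
Proof.
have [d0 d00 dC dT] := distP.
move=> sep.
have [[x0 _]|T0] := pselect (exists x : T, True); last first.
  by move=> _ A mA; rewrite (_ : _ `&` _ = set0)//; apply/seteqP; split => // x _;
    exfalso; apply: T0; exists x.1.
have [s sdense] := metric_separable_seq x0 sep.
have ms n : measurable_fun setT (fun x => dist x (s n)).
  move=> _; apply: (measurability _ (RGenInftyO.measurableE R)) => //.
  move=> _ [_ [r ->] <-]; rewrite setTI.
  rewrite (_ : _ @^-1` _ = [set y | (dist y (s n) < r)%R]).
    exact: measurable_metric_ball.
  by apply/seteqP; split => x /=; rewrite in_itv.
move=> _; apply: (measurability _ (RGenInftyO.measurableE R)) => //.
move=> _ [_ [r ->] <-]; rewrite setTI.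
rewrite (_ : _ @^-1` _ =
    \bigcup_n [set z : T * T | (dist z.1 (s n) + dist z.2 (s n) < r)%R]).
  apply: bigcupT_measurable => n.
  rewrite (_ : [set z : T * T | _] =
    (fun z : T * T => dist z.1 (s n) + dist z.2 (s n))%R @^-1` `]-oo, r[).
    rewrite -[X in measurable X]setTI; apply: measurable_funD => //.
    - exact: (measurableT_comp (ms n)).
    - exact: (measurableT_comp (ms n)).
  by apply/seteqP; split => x /=; rewrite in_itv.
apply/seteqP; split => [[x y]|[x y] [n _]] /=; rewrite in_itv/=.
  move=> xyr.
  (* The sum of the distances to [s n] is at most [dist x y + 2 * dist y (s n)], so half of the gap
     suffices. *)
  have /(sdense y)[n yn] : (0 < (r - dist x y) / 2)%R.
    by rewrite divr_gt0// subr_gt0.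
  exists n => //=; have := dT x y (s n); lra.
by apply: le_lt_trans; rewrite (dC y).
Qed.

(** Balls of radius [delta / 2] around a dense sequence cover the space; removing from each ball the
    earlier ones makes them disjoint. *)
Lemma small_borel_partition (delta : R) : metric_separable dist -> (0 < delta)%R ->
  exists B : nat -> set T, [/\ forall n, measurable (B n), trivIset setT B,
    \bigcup_n B n = setT &
    forall n x y, B n x -> B n y -> (dist x y <= delta)%R].
Proof.
have [d0 d00 dC dT] := distP.
move=> sep delta0.
have [[x0 _]|T0] := pselect (exists x : T, True); last first.
  exists (fun=> set0); split => //.
  - by apply/trivIsetP => ? ? _ _ _; rewrite set0I.
  - by apply/seteqP; split => // x; exfalso; apply: T0; exists x.
have [s sdense] := metric_separable_seq x0 sep.
have d2 : (0 < delta / 2)%R by rewrite divr_gt0.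
exists (seqDU (fun n => [set x | (dist x (s n) < delta / 2)%R])); split.
- by apply: seqDU_measurable => n; exact: measurable_metric_ball.
- exact: trivIset_seqDU.
- rewrite -seqDU_bigcup_eq; apply/seteqP; split => // x _.
  by have [n xn] := sdense x _ d2; exists n.
- move=> n x y [/= xn _] [/= yn _].
  have := dT x (s n) y; rewrite (dC (s n)); lra.
Qed.

End borel_metric.

(** * Lp norms under dominated push-forwards *)

Section dominated_pushforward.
Context (R : realType) (dA dB dC : measure_display)
  (A : measurableType dA) (B : measurableType dB) (C : measurableType dC).
Variables (m : probability A R) (n : probability B R) (g : A -> C) (h : B -> C).
Hypotheses (mg : measurable_fun setT g) (mh : measurable_fun setT h).
Variable c : R.
Hypothesis c0 : (0 <= c)%R.
Hypothesis mn : forall S, measurable S -> m (g @^-1` S) <= c%:E * n (h @^-1` S).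

(** Both integrals are moved to [C] by push-forward, where the image of [m] is at most [c] times the
    image of [n]. Having two maps [g] and [h] allows measures on different spaces to be compared. *)
Lemma ge0_le_integral_scale (f : C -> \bar R) :
  measurable_fun setT f -> (forall x, 0 <= f x) ->
  \int[m]_x f (g x) <= c%:E * \int[n]_x f (h x).
Proof.
move=> mf f0.
have := @ge0_integral_pushforward _ _ _ _ R _ mg m setT f measurableT mf (fun x _ => f0 x).
rewrite preimage_setT => <-.
have := @ge0_integral_pushforward _ _ _ _ R _ mh n setT f measurableT mf (fun x _ => f0 x).
rewrite preimage_setT => <-.
rewrite -(@ge0_integral_mscale _ _ R (image_probability n mh) setT measurableT (NngNum c0))//.
exact: (@ge0_le_measure_integral _ _ _ (image_probability m mg)
  (mscale (NngNum c0) (image_probability n mh))).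
Qed.

Lemma ae_le_scale (f : C -> \bar R) y : measurable_fun setT f ->
  (\forall x \ae n, f (h x) <= y) -> \forall x \ae m, f (g x) <= y.
Proof.
move=> mf /ae_le_measureP n0; apply/ae_le_measureP.
  exact: measurableT_comp.
have mS : measurable (f @^-1` `]y, +oo[).
  by rewrite -[X in measurable X]setTI; apply: mf => //; exact: emeasurable_itv.
apply/eqP; rewrite eq_le measure_ge0 andbT.
apply: le_trans (mn mS) _; rewrite -comp_preimage n0 ?mule0//.
exact: measurableT_comp.
Qed.

(** For finite [r] the factor [c] comes out of the integral and is raised to [1/r]; at infinity only
    null sets matter and no factor appears. *)
Lemma Lnorm_le_scale (p : \bar R) (F : C -> R) : 1 <= p -> measurable_fun setT F ->
  'N[m]_p[EFin \o (F \o g)] <=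
  (if p is r%:E then (c `^ r^-1)%:E else 1) * 'N[n]_p[EFin \o (F \o h)].
Proof.
move=> p1 mF; rewrite unlock /Lnorm; case: p p1 => [r|_|//].
- rewrite lee_fin => r1.
  have r0 : (0 < r)%R by exact: lt_le_trans r1.
  rewrite -poweR_EFin -poweRM ?lee_fin//; last by apply: integral_ge0 => x _; exact: poweR_ge0.
  have mFr : measurable_fun setT (fun x => (`|F x| `^ r)%:E).
    by apply/measurable_EFinP/(measurableT_comp (measurable_powR r))/measurableT_comp.
  have Fr0 x : 0 <= (`|F x| `^ r)%:E by rewrite lee_fin powR_ge0.
  apply: gt0_ler_poweR; rewrite ?invr_ge0 ?(ltW r0)// ?in_itv/= ?leey ?andbT.
  + by apply: integral_ge0 => x _; exact: Fr0.
  + by rewrite mule_ge0//; apply: integral_ge0 => x _; exact: Fr0.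
  + exact: (ge0_le_integral_scale mFr Fr0).
- rewrite mul1e !ifT; [|by rewrite [ltRHS]probability_setT..].
  apply/ess_supP.
  apply: (@ae_le_scale (fun x => `|(F x)%:E|)).
    by apply: measurableT_comp => //; exact/measurable_EFinP.
  exact: ess_sup_ge.
Qed.

End dominated_pushforward.

Section compare_products.
Context (R : realType) (dA dB dC : measure_display)
  (A : measurableType dA) (B : measurableType dB) (C : measurableType dC).
Variables (m : probability A R) (n : probability B R) (g : A -> C) (h : B -> C).
Hypotheses (mg : measurable_fun setT g) (mh : measurable_fun setT h).
Variable c : R.
Hypothesis c0 : (0 <= c)%R.
Hypothesis mn : forall S, measurable S -> m (g @^-1` S) <= c%:E * n (h @^-1` S).

Let gg (z : A * A) := (g z.1, g z.2).
Let hh (z : B * B) := (h z.1, h z.2).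

Let mgg : measurable_fun setT gg.
Proof. by apply: measurable_fun_pair; exact: measurableT_comp. Qed.
Let mhh : measurable_fun setT hh.
Proof. by apply: measurable_fun_pair; exact: measurableT_comp. Qed.

Lemma product_measure_le_scale (S : set (C * C)) : measurable S ->
  (m \x m) (gg @^-1` S) <= (c ^+ 2)%:E * (n \x n) (hh @^-1` S).
Proof.
move=> mS.
(* These sets are the sections of the preimage of [S] under [k], hence the measurability. *)
have mphi : measurable_fun setT (fun x => n (h @^-1` (xsection S x))).
  pose k (z : C * B) := (z.1, h z.2).
  have mk : measurable_fun setT k.
    by apply: measurable_fun_pair => //; exact: measurableT_comp.
  have mkS : measurable (k @^-1` S) by rewrite -[X in measurable X]setTI; exact: mk.
  rewrite (_ : (fun x => _) = n \o xsection (k @^-1` S)).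
    exact: measurable_fun_xsection.
  by apply/funext => x /=; congr (n _).
(* The comparison of [m] with [n] is applied to each section, giving one factor [c]; applied again
   to the integral over the first coordinate, it gives the other. *)
apply: (@le_trans _ _ (\int[m]_x (c%:E * n (h @^-1` (xsection S (g x)))))).
  apply: ge0_le_integral => //.
  - by apply: measurable_fun_xsection; rewrite -[X in measurable X]setTI; exact: mgg.
  - apply: emeasurable_funM => //; exact: (measurableT_comp mphi).
  - move=> x _; apply: le_trans (mn (measurable_xsection _ mS)).
    by rewrite /= le_eqVlt; apply/orP; left; apply/eqP; congr (m _);
      apply/seteqP; split => y /=; rewrite /xsection/= !inE.
rewrite ge0_integralZl_EFin//; last exact: (measurableT_comp mphi).
rewrite expr2 EFinM -muleA lee_wpmul2l ?lee_fin//.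
apply: le_trans (ge0_le_integral_scale mg mh c0 mn mphi _) _ => //.
Qed.

(** Here the exponent [2/p] arises: the product measures compare with constant [c ^+ 2], whose power
    [1/r] is [c] to the [2/r]. The argument [c - 1] compensates for the [1 +] inside [coef]. *)
Lemma Lnorm_product_le_scale (p : \bar R) (F : C * C -> R) :
  1 <= p -> measurable_fun setT F ->
  'N[m \x m]_p[(fun z => (F (g z.1, g z.2))%:E)] <=
  (coef (c - 1) p)%:E * 'N[n \x n]_p[(fun z => (F (h z.1, h z.2))%:E)].
Proof.
move=> p1 mF.
have := @Lnorm_le_scale _ _ _ _ _ _ _ (m \x m) (n \x n) gg hh mgg mhh (c ^+ 2)%R
  (sqr_ge0 c) product_measure_le_scale p F p1 mF.
congr (_ <= _ * _); case: p {p1} => //= r.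
by rewrite addrC subrK -powR_mulrn// -powRrM.
Qed.

End compare_products.

(** * Gluing along a countable partition *)

(* With division by zero the weight r / (p * q) is 0 when p = 0 or q = 0; the
   hypotheses then force x = 0. *)
Lemma ratio_bounds (R : realFieldType) (a b p q r x : R) :
  (0 <= a -> 0 <= b -> 0 <= p -> 0 <= q -> 0 <= r -> 0 <= x -> x <= p ->
  p <= a * r -> r <= a * p -> q <= b * r -> r <= b * q ->
  r / (p * q) * (x * q) <= a * x /\ x <= a * (r / (p * q) * (x * q)))%R.
Proof.
move=> a0 b0 p0 q0 r0 x0 xp par rap qbr rbq.
have [p_eq0|pN0] := eqVneq p 0%R.
  have -> : x = 0%R by apply/eqP; rewrite eq_le x0 andbT -p_eq0.
  by rewrite !(mul0r, mulr0).
(* Once [p] is nonzero this case is void: [q = 0] forces [r = 0], and then [p = 0]. *)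
have [q_eq0|qN0] := eqVneq q 0%R.
  exfalso; move: rbq; rewrite q_eq0 mulr0 => rle0.
  have re0 : r = 0%R by apply/eqP; rewrite eq_le r0 rle0.
  by move: par; rewrite re0 mulr0 leNgt lt0r pN0 p0.
have pgt0 : (0 < p)%R by rewrite lt0r pN0.
(* After cancelling [q], what remains is the ratio [r / p], which lies between [1/a] and [a]. *)
have -> : (r / (p * q) * (x * q) = r * x / p)%R by field; rewrite pN0 qN0.
rewrite ler_pdivrMr// mulrA mulrA ler_pdivlMr//; split.
  by rewrite mulrAC ler_wpM2r.
by rewrite mulrC ler_wpM2r.
Qed.

Section gluing_one_marginal.
Context (R : realType) (d dY : measure_display)
  (T : measurableType d) (Y : measurableType dY).
Variables (nu : probability T R) (mu : probability Y R) (h : T -> Y).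
Hypothesis mh : measurable_fun setT h.
Variables (a b : R) (P : nat -> set Y) (q : nat -> R).
Hypotheses (a0 : (0 <= a)%R) (b0 : (0 <= b)%R).
Hypotheses (mP : forall n, measurable (P n)) (tP : trivIset setT P)
  (PT : \bigcup_n P n = setT).
Hypotheses
  (nu_le : forall S, measurable S -> nu (h @^-1` S) <= a%:E * mu S)
  (le_nu : forall S, measurable S -> mu S <= a%:E * nu (h @^-1` S))
  (q0 : forall n, (0 <= q n)%R)
  (q_le : forall n, (q n)%:E <= b%:E * mu (P n))
  (le_q : forall n, mu (P n) <= b%:E * (q n)%:E).

Let mhP n : measurable (h @^-1` P n).
Proof. by rewrite -[X in measurable X]setTI; exact: mh. Qed.

Lemma measure_sum_preimage S : measurable S ->
  nu S = \sum_(0 <= n <oo) nu (S `&` h @^-1` P n).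
Proof.
move=> mS.
rewrite -[in LHS](setIT S) -(preimage_setT h) -PT preimage_bigcup setI_bigcupr.
rewrite [LHS]measure_bigcup//.
- by apply: eq_eseriesl => n; rewrite in_setT.
- by move=> n _; exact: measurableI.
- apply/trivIsetP => i j _ _ ij; apply/seteqP; split => // x [[_ xi] [_ xj]].
  by move/trivIsetP : tP => /(_ i j I I ij) /seteqP[/(_ (h x)) + _]; apply; split.
Qed.

Let p n := fine (nu (h @^-1` P n)).
Let r n := fine (mu (P n)).

(** The sum is a marginal of the glued measure, [q n] being the mass of the n-th cell under the
    other plan. The bounds hold cell by cell and are then summed; stated for one side only, they
    serve for both marginals. *)
Lemma reweighted_sum_bounds S : measurable S ->
  let s := \sum_(0 <= n <oo) (r n / (p n * q n))%:E *
             (nu (S `&` h @^-1` P n) * (q n)%:E) in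
  s <= a%:E * nu S /\ nu S <= a%:E * s.
Proof.
move=> mS s.
have mI n : measurable (S `&` h @^-1` P n) by exact: measurableI.
have toR (x y : \bar R) (c : R) : x \is a fin_num -> y \is a fin_num ->
   x <= c%:E * y -> (fine x <= c * fine y)%R.
  by move=> xf yf; rewrite -lee_fin EFinM !fineK.
have bounds n : (r n / (p n * q n) * (fine (nu (S `&` h @^-1` P n)) * q n) <=
     a * fine (nu (S `&` h @^-1` P n)) /\
     fine (nu (S `&` h @^-1` P n)) <=
     a * (r n / (p n * q n) * (fine (nu (S `&` h @^-1` P n)) * q n)))%R.
  apply: (@ratio_bounds R a b) => //; rewrite ?fine_ge0//.
  - by rewrite fine_le ?fin_num_measure// le_measure ?inE//; exact: subIsetr.
  - by apply: toR; rewrite ?fin_num_measure//; exact: nu_le.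
  - by apply: toR; rewrite ?fin_num_measure//; exact: le_nu.
  - by rewrite -[q n]/(fine (q n)%:E); apply: toR; rewrite ?fin_num_measure.
  - by rewrite -[q n]/(fine (q n)%:E); apply: toR; rewrite ?fin_num_measure.
have p0 n : (0 <= p n)%R by rewrite fine_ge0.
have r0 n : (0 <= r n)%R by rewrite fine_ge0.
have t0 n : 0 <= (r n / (p n * q n))%:E * (nu (S `&` h @^-1` P n) * (q n)%:E).
  by rewrite mule_ge0 ?lee_fin ?divr_ge0 ?mulr_ge0// mule_ge0 ?lee_fin.
rewrite (measure_sum_preimage mS) /s.
split; rewrite -nneseriesZl//; apply: lee_nneseries => //.
- move=> n _.
  by rewrite -[nu _]fineK ?fin_num_measure// -!EFinM lee_fin; case: (bounds n).
- move=> n _.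
  by rewrite -[nu _]fineK ?fin_num_measure// -!EFinM lee_fin; case: (bounds n).
Qed.

End gluing_one_marginal.

Section gluing.
Context (R : realType) (dA dB dY : measure_display)
  (A : measurableType dA) (B : measurableType dB) (Y : measurableType dY).
Variables (pi : probability A R) (sigma : probability B R) (mu : probability Y R).
Variables (f : A -> Y) (g : B -> Y).
Hypotheses (mf : measurable_fun setT f) (mg : measurable_fun setT g).
Variables (a b : R).
Hypotheses (a0 : (0 <= a)%R) (b0 : (0 <= b)%R).
Hypotheses
  (pi_le : forall S, measurable S -> pi (f @^-1` S) <= a%:E * mu S)
  (le_pi : forall S, measurable S -> mu S <= a%:E * pi (f @^-1` S))
  (sigma_le : forall S, measurable S -> sigma (g @^-1` S) <= b%:E * mu S)
  (le_sigma : forall S, measurable S -> mu S <= b%:E * sigma (g @^-1` S)).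
Variable P : nat -> set Y.
Hypotheses (mP : forall n, measurable (P n)) (tP : trivIset setT P)
  (PT : \bigcup_n P n = setT).

Let mfP n : measurable (f @^-1` P n).
Proof. by rewrite -[X in measurable X]setTI; exact: mf. Qed.
Let mgP n : measurable (g @^-1` P n).
Proof. by rewrite -[X in measurable X]setTI; exact: mg. Qed.

Let cell n : set (A * B) := (f @^-1` P n) `*` (g @^-1` P n).
Let mcell n : measurable (cell n).
Proof. exact: measurableX. Qed.

Let p n := fine (pi (f @^-1` P n)).
Let q n := fine (sigma (g @^-1` P n)).
Let r n := fine (mu (P n)).
Let w n : {nonneg R} :=
  NngNum (divr_ge0 (fine_ge0 (measure_ge0 mu (P n)))
    (mulr_ge0 (fine_ge0 (measure_ge0 pi (f @^-1` P n)))
       (fine_ge0 (measure_ge0 sigma (g @^-1` P n))))).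

(** Built from scaled restrictions and a series, so that countable additivity comes with the
    construction; [w n] is the weight [r n / (p n * q n)] packed with its nonnegativity. *)
Definition glue : {measure set (A * B) -> \bar R} :=
  mseries (fun n => mscale (w n) (mrestr (pi \x sigma) (mcell n))) 0.

Let q0 n : (0 <= q n)%R. Proof. exact: fine_ge0. Qed.
Let p0 n : (0 <= p n)%R. Proof. exact: fine_ge0. Qed.

Let cell_massE n S1 S2 : measurable S1 -> measurable S2 ->
  mscale (w n) (mrestr (pi \x sigma) (mcell n)) (S1 `*` S2) =
  (r n / (p n * q n))%:E *
    (pi (S1 `&` f @^-1` P n) * sigma (S2 `&` g @^-1` P n)).
Proof.
move=> mS1 mS2; rewrite -product_measure1E; [|exact: measurableI..].
by rewrite setXI.
Qed.

Lemma glue_fst S : measurable S ->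
  glue (S `*` setT) <= a%:E * pi S /\ pi S <= a%:E * glue (S `*` setT).
Proof.
move=> mS.
have -> : glue (S `*` setT) = \sum_(0 <= n <oo) (r n / (p n * q n))%:E *
             (pi (S `&` f @^-1` P n) * (q n)%:E).
  apply: eq_eseriesr => n _; rewrite [LHS]cell_massE// setTI.
  by rewrite fineK ?fin_num_measure.
apply: (reweighted_sum_bounds mf a0 b0 mP tP PT pi_le le_pi q0) => // n.
- by rewrite fineK ?fin_num_measure//; exact: sigma_le.
- by rewrite fineK ?fin_num_measure//; exact: le_sigma.
Qed.

(** The weight is symmetric in [p] and [q], so the one-marginal bounds apply with the two plans
    exchanged. *)
Lemma glue_snd S : measurable S ->
  glue (setT `*` S) <= b%:E * sigma S /\ sigma S <= b%:E * glue (setT `*` S).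
Proof.
move=> mS.
have -> : glue (setT `*` S) = \sum_(0 <= n <oo) (r n / (q n * p n))%:E *
             (sigma (S `&` g @^-1` P n) * (p n)%:E).
  apply: eq_eseriesr => n _; rewrite [LHS]cell_massE// setTI.
  by rewrite [(q n * _)%R]mulrC [X in _ * X = _]muleC fineK ?fin_num_measure.
apply: (reweighted_sum_bounds mg b0 a0 mP tP PT sigma_le le_sigma p0) => // n.
- by rewrite fineK ?fin_num_measure//; exact: pi_le.
- by rewrite fineK ?fin_num_measure//; exact: le_pi.
Qed.

(** Each cell has mass exactly [mu (P n)], and these masses sum to 1. *)
Lemma glue_setT : glue setT = 1.
Proof.
rewrite -(probability_setT mu) -PT measure_bigcup//.
rewrite (@eq_eseriesl _ _ (fun n => true)); last by move=> n; rewrite in_setT.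
apply: eq_eseriesr => n _; rewrite -setXTT [LHS]cell_massE// !setTI.
rewrite -[pi _]fineK ?fin_num_measure// -[sigma _]fineK ?fin_num_measure//.
rewrite -[RHS]fineK ?fin_num_measure// -!EFinM; congr EFin.
rewrite -/(p n) -/(q n) -/(r n).
(* If [p n] or [q n] is 0, the weight is 0 by the convention on division; the cell mass is still
   right because domination forces [mu (P n)] to be 0. *)
have le_r (c s : R) (z : \bar R) : z \is a fin_num -> fine z = s ->
  mu (P n) <= c%:E * z -> s = 0%R -> r n = 0%R.
  move=> zf <- mz z0; apply/eqP; rewrite eq_le fine_ge0// andbT.
  by rewrite -lee_fin fineK ?fin_num_measure// (le_trans mz)// -(fineK zf) z0 mule0.
have [p_eq0|pN0] := eqVneq (p n) 0%R.
  rewrite p_eq0 !mul0r mulr0; apply/esym.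
  by apply: (le_r _ _ _ _ _ (le_pi (mP n))) => //; rewrite fin_num_measure.
have [q_eq0|qN0] := eqVneq (q n) 0%R.
  rewrite q_eq0 !mulr0; apply/esym.
  by apply: (le_r _ _ _ _ _ (le_sigma (mP n))) => //; rewrite fin_num_measure.
by field; rewrite pN0 qN0.
Qed.

(** The complement of the union of the cells misses every cell, so each term of the series vanishes
    on it. *)
Lemma ae_glue : \forall z \ae glue, exists n, P n (f z.1) /\ P n (g z.2).
Proof.
have mU : measurable (\bigcup_n cell n) by exact: bigcupT_measurable.
exists (~` \bigcup_n cell n); split.
- exact: measurableC.
- rewrite /= /mseries eseries0// => n _ _.
  change ((w n)%:num%:E * (pi \x sigma) (~` (\bigcup_n cell n) `&` cell n) = 0).
  rewrite (_ : _ `&` _ = set0) ?measure0 ?mule0//.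
  by apply/seteqP; split => // z [/= nz zn]; apply: nz; exists n.
- by move=> z /= + [n _ [/= fz gz]]; apply; exists n.
Qed.

End gluing.

(** * Composing two plans *)

(** Trades densities for setwise inequalities, which compose by multiplying constants and pass to
    push-forwards. *)
Lemma mutually_boundedP (R : realType) (d : measure_display)
    (T : measurableType d) (nu mu : {measure set T -> \bar R}) (c : R) :
  fin_num_fun nu -> fin_num_fun mu -> (0 <= c)%R ->
  mutually_bounded nu mu c <->
  forall A, measurable A -> nu A <= c%:E * mu A /\ mu A <= c%:E * nu A.
Proof.
move=> finnu finmu c0; split=> [[_ _ numu munu] A mA|bnd].
  by split; exact: le_of_RN_bounded.
have dom (m1 m2 : {measure set T -> \bar R}) :
    (forall A, measurable A -> m1 A <= c%:E * m2 A) -> m1 `<< m2.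
  move=> m12; apply/null_content_dominatesP => A mA m20; apply/eqP.
  by rewrite eq_le measure_ge0 andbT (le_trans (m12 A mA))// m20 mule0.
by split; [apply: dom|apply: dom|apply: RN_bounded_of_le|apply: RN_bounded_of_le] => //;
  move=> A /bnd[].
Qed.

Lemma S_epsP (R : realType) (dx dy : measure_display) (X : measurableType dx)
    (Y : measurableType dy) (e1 e2 : R) (muX : probability X R)
    (muY : probability Y R) (pi : probability (X * Y)%type R) :
  (0 <= e1)%R -> (0 <= e2)%R ->
  S_eps e1 e2 muX muY pi <->
  (forall A, measurable A -> pi (fst @^-1` A) <= (1 + e1)%:E * muX A /\
                             muX A <= (1 + e1)%:E * pi (fst @^-1` A)) /\
  (forall A, measurable A -> pi (snd @^-1` A) <= (1 + e2)%:E * muY A /\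
                             muY A <= (1 + e2)%:E * pi (snd @^-1` A)).
Proof.
move=> e10 e20.
have fin1 : fin_num_fun (marginal1 pi).
  by move=> A mA; apply: fin_num_measure; rewrite -[X in measurable X]setTI; exact: measurable_fst.
have fin2 : fin_num_fun (marginal2 pi).
  by move=> A mA; apply: fin_num_measure; rewrite -[X in measurable X]setTI; exact: measurable_snd.
have finX : fin_num_fun muX by move=> A mA; exact: fin_num_measure.
have finY : fin_num_fun muY by move=> A mA; exact: fin_num_measure.
rewrite /S_eps (mutually_boundedP fin1 finX) ?addr_ge0//.
by rewrite (mutually_boundedP fin2 finY) ?addr_ge0.
Qed.

(** * Distortion as an Lp norm, and auxiliary facts on norms and distances *)

(** Gives access to Minkowski's inequality. At infinity the norm is guarded by positivity of the
    total mass, which is 1 here. *)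
Lemma distortionE (R : realType) (dx dy : measure_display)
    (X : measurableType dx) (Y : measurableType dy)
    (distX : X -> X -> R) (distY : Y -> Y -> R) (p : \bar R)
    (pi : probability (X * Y)%type R) : 1 <= p ->
  distortion distX distY p pi =
  'N[pi \x pi]_p[(fun z => (distX z.1.1 z.2.1 - distY z.1.2 z.2.2)%:E)].
Proof.
rewrite unlock /distortion; case: p => //= _.
by rewrite ifT//; rewrite [ltRHS]probability_setT.
Qed.

Lemma ae_le_Lnorm (R : realType) (d : measure_display) (T : measurableType d)
    (m : probability T R) (p : \bar R) (f g : T -> R) :
  1 <= p -> measurable_fun setT f -> measurable_fun setT g ->
  (\forall x \ae m, (`|f x| <= `|g x|)%R) ->
  'N[m]_p[EFin \o f] <= 'N[m]_p[EFin \o g].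
Proof.
move=> p1 mf mg fg; rewrite unlock /Lnorm; case: p p1 => [r|_|//].
- rewrite lee_fin => r1.
  have r0 : (0 < r)%R by exact: lt_le_trans r1.
  have mr (u : T -> R) : measurable_fun setT u ->
      measurable_fun setT (fun x => (`|u x| `^ r)%:E).
    by move=> mu; apply/measurable_EFinP/(measurableT_comp (measurable_powR r))/measurableT_comp.
  have pow0 (u : T -> R) x : 0 <= (`|u x| `^ r)%:E by rewrite lee_fin powR_ge0.
  apply: gt0_ler_poweR; rewrite ?invr_ge0 ?(ltW r0)// ?in_itv/= ?leey ?andbT.
  + by apply: integral_ge0 => x _; exact: pow0.
  + by apply: integral_ge0 => x _; exact: pow0.
  + apply: ae_ge0_le_integral => //; [exact: mr|exact: mr|].
    by apply: filterS fg => x fgx _; rewrite lee_fin ge0_ler_powR ?nnegrE// ltW.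
- rewrite !ifT; [|by rewrite [ltRHS]probability_setT..].
  by apply: le_ess_sup; apply: filterS fg => x; rewrite lee_fin.
Qed.

Lemma Lnorm_probability_cst (R : realType) (d : measure_display)
    (T : measurableType d) (m : probability T R) (p : \bar R) (c : R) :
  1 <= p -> (0 <= c)%R -> 'N[m]_p[EFin \o cst c] = c%:E.
Proof.
move=> p1 c0; rewrite unlock /Lnorm; case: p p1 => [r|_|//].
- rewrite lee_fin => r1; have r0 : r != 0%R by rewrite gt_eqF// (lt_le_trans _ r1).
  under eq_integral do rewrite /= ger0_norm//.
  rewrite integral_cst// [X in _ * X]probability_setT mule1 poweR_EFin.
  by rewrite -powRrM mulfV// powRr1.
- rewrite ifT; last by rewrite [ltRHS]probability_setT.
  rewrite (_ : abse \o _ = cst c%:E); last by apply/funext => x /=; rewrite ger0_norm.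
  by rewrite ess_sup_cst//; rewrite [ltRHS]probability_setT.
Qed.

(** The exceptional set lies in the union of two cylinders over a null set, each null for the
    product measure. *)
Lemma ae_product (R : realType) (d : measure_display) (T : measurableType d)
    (m : probability T R) (P : T -> Prop) :
  (\forall x \ae m, P x) -> \forall z \ae m \x m, P z.1 /\ P z.2.
Proof.
move=> [N [mN N0 PN]].
have m1 : \forall z \ae m \x m, P z.1.
  exists (N `*` setT); split; first exact: measurableX.
    by rewrite [LHS]product_measure1E// [X in X * _]N0 mul0e.
  by move=> z /= Pz; split => //; exact: PN.
have m2 : \forall z \ae m \x m, P z.2.
  exists (setT `*` N); split; first exact: measurableX.
    by rewrite [LHS]product_measure1E// [X in _ * X]N0 mule0.
  by move=> z /= Pz; split => //; exact: PN.
by apply: filterS2 m1 m2.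
Qed.

Lemma coef_ge0 (R : realType) (e : R) (p : \bar R) : (0 <= coef e p)%R.
Proof. by case: p => //= r; exact: powR_ge0. Qed.

Lemma coef_gt0 (R : realType) (e : R) (p : \bar R) :
  (0 <= e)%R -> (0 < coef e p)%R.
Proof. by move=> e0; case: p => //= r; rewrite powR_gt0// ltr_pwDl. Qed.

Lemma coef0 (R : realType) (p : \bar R) : coef 0%R p = 1%R :> R.
Proof. by case: p => //= r; rewrite addr0 powR1. Qed.

Lemma dist_quadrilateral (R : realType) (T : Type) (dist : T -> T -> R) x y x' y' :
  is_metric dist -> (`|dist x x' - dist y y'| <= dist x y + dist x' y')%R.
Proof.
move=> [_ _ dC dT].
have := dT x y x'; have := dT y y' x'; have := dT y x y'; have := dT x x' y'.
rewrite (dC y' x') (dC y x) ler_norml => *.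
by apply/andP; split; lra.
Qed.

(** * Composition of plans up to an error [delta] *)

Section approximate_composition.
Context (R : realType) (e1 e2 : R) (p : \bar R) (dx dy dz : measure_display)
  (X : measurableType dx) (Y : measurableType dy) (Z : measurableType dz)
  (distX : X -> X -> R) (distY : Y -> Y -> R) (distZ : Z -> Z -> R)
  (muX : probability X R) (muY : probability Y R) (muZ : probability Z R).
Hypotheses (e10 : (0 <= e1)%R) (e20 : (0 <= e2)%R) (p1 : 1 <= p).
Hypotheses (cX : compact_pmm_space distX) (cY : compact_pmm_space distY)
  (cZ : compact_pmm_space distZ).
Variables (pi : probability (X * Y)%type R) (sigma : probability (Y * Z)%type R).
Hypotheses (Spi : S_eps e1 e2 muX muY pi) (Ssigma : S_eps e1 e2 muY muZ sigma).

Let W := ((X * Y) * (Y * Z))%type.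

Let mdX : measurable_fun setT (fun z : X * X => distX z.1 z.2).
Proof. by case: cX => m _ s _ b; exact: measurable_dist. Qed.
Let mdY : measurable_fun setT (fun z : Y * Y => distY z.1 z.2).
Proof. by case: cY => m _ s _ b; exact: measurable_dist. Qed.
Let mdZ : measurable_fun setT (fun z : Z * Z => distZ z.1 z.2).
Proof. by case: cZ => m _ s _ b; exact: measurable_dist. Qed.

Let mdiff d1 d2 (T1 : measurableType d1) (T2 : measurableType d2)
    (f : T1 * T1 -> R) (g : T2 * T2 -> R) :
  measurable_fun setT f -> measurable_fun setT g ->
  measurable_fun setT (fun z : (T1 * T2) * (T1 * T2) =>
    f (z.1.1, z.2.1) - g (z.1.2, z.2.2))%R.
Proof.
move=> mf mg; apply: measurable_funB.
- apply: (measurableT_comp mf); apply: measurable_fun_pair.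
  + exact: (measurableT_comp measurable_fst measurable_fst).
  + exact: (measurableT_comp measurable_fst measurable_snd).
- apply: (measurableT_comp mg); apply: measurable_fun_pair.
  + exact: (measurableT_comp measurable_snd measurable_fst).
  + exact: (measurableT_comp measurable_snd measurable_snd).
Qed.

Let ends (w : W) : X * Z := (w.1.1, w.2.2).
Let mends : measurable_fun setT ends.
Proof.
apply: measurable_fun_pair.
- exact: (measurableT_comp measurable_fst measurable_fst).
- exact: (measurableT_comp measurable_snd measurable_snd).
Qed.

(** [rho] is the law of the outer coordinates under the glued measure [tau]; [delta] pays for the
    mismatch of its two [Y]-coordinates. *)
Lemma approximate_composition (delta : R) : (0 < delta)%R ->
  exists rho : probability (X * Z)%type R,
    S_eps (e1 + e2 + e1 * e2) (e1 + e2 + e1 * e2) muX muZ rho /\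
    distortion distX distZ p rho <=
      (coef e2 p)%:E * distortion distX distY p pi + delta%:E +
      (coef e1 p)%:E * distortion distY distZ p sigma.
Proof.
move=> delta0.
have [pi1 pi2] := (S_epsP muX muY pi e10 e20).1 Spi.
have [sg1 sg2] := (S_epsP muY muZ sigma e10 e20).1 Ssigma.
case: cY => metY _ sepY _ borY.
(* The distortion involves two points of [W], each contributing one mismatch, hence cells of
   diameter [delta / 2]. *)
have [P [mP tP PT Psmall]] : exists P : nat -> set Y,
    [/\ forall n, measurable (P n), trivIset setT P, \bigcup_n P n = setT &
      forall n x y, P n x -> P n y -> (distY x y <= delta / 2)%R].
  by apply: small_borel_partition => //; rewrite divr_gt0.
have e10' : (0 <= 1 + e1)%R by rewrite addr_ge0.
have e20' : (0 <= 1 + e2)%R by rewrite addr_ge0.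
(* The constants cross over: [Y] is the second marginal of [pi], with bound [1 + e2], and the first
   of [sigma], with bound [1 + e1]. So [tau] is compared with [pi] at cost [1 + e2] and with [sigma]
   at cost [1 + e1]. *)
pose g := glue pi sigma muY (@measurable_snd _ _ X Y) (@measurable_fst _ _ Y Z) mP.
have pi_le S mS := (pi2 S mS).1. have le_pi S mS := (pi2 S mS).2.
have sg_le S mS := (sg1 S mS).1. have le_sg S mS := (sg1 S mS).2.
have gT : g setT = 1 by exact: (glue_setT _ _ le_pi le_sg mP tP PT).
pose tau : probability W R := as_probability gT.
have tau1 (S : set (X * Y)) : measurable S ->
    tau (fst @^-1` S) <= (1 + e2)%:E * pi S /\
    pi S <= (1 + e2)%:E * tau (fst @^-1` S).
  move=> mS; rewrite (_ : _ @^-1` _ = S `*` setT); last first.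
    by apply/seteqP; split => [[u v]|[u v] []].
  exact: (glue_fst _ _ e20' e10' pi_le le_pi sg_le le_sg mP tP PT).
have tau2 (S : set (Y * Z)) : measurable S ->
    tau (snd @^-1` S) <= (1 + e1)%:E * sigma S /\
    sigma S <= (1 + e1)%:E * tau (snd @^-1` S).
  move=> mS; rewrite (_ : _ @^-1` _ = setT `*` S); last first.
    by apply/seteqP; split => [[u v]|[u v] []].
  exact: (glue_snd _ _ e20' e10' pi_le le_pi sg_le le_sg mP tP PT).
have tauP : \forall w \ae tau, exists n, P n w.1.2 /\ P n w.2.1.
  exact: ae_glue.
pose rho := image_probability tau mends.
have mpre d1 d2 (T1 : measurableType d1) (T2 : measurableType d2) (f : T1 -> T2) :
    measurable_fun setT f -> forall A, measurable A -> measurable (f @^-1` A).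
  by move=> mf A mA; rewrite -[X in measurable X]setTI; exact: mf.
have chain (a b : R) (u v t : \bar R) : (0 <= a)%R ->
    u <= a%:E * v -> v <= b%:E * t -> u <= (a * b)%:E * t.
  by move=> a0 uv vt; rewrite (le_trans uv)// EFinM -muleA lee_wpmul2l ?lee_fin.
(* On [X] the costs are [1 + e2] from [tau] to [pi], then [1 + e1] to [muX]; on [Z] they are
   [1 + e1], then [1 + e2]. Both products agree, so one tolerance serves both marginals. *)
have epsE : (1 + (e1 + e2 + e1 * e2) = (1 + e1) * (1 + e2))%R by ring.
exists rho; split.
  apply/S_epsP; rewrite ?addr_ge0 ?mulr_ge0//; split=> A mA; rewrite epsE.
    have [t1 t2] := tau1 _ (mpre _ _ _ _ _ measurable_fst A mA).
    have [m1 m2] := pi1 A mA.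
    split; first by rewrite mulrC; exact: chain t1 m1.
    exact: chain m2 t2.
  have [t1 t2] := tau2 _ (mpre _ _ _ _ _ measurable_snd A mA).
  have [m1 m2] := sg2 A mA.
  split; first exact: chain t1 m1.
  by rewrite mulrC; exact: chain m2 t2.
rewrite !distortionE//.
pose F1 (z : (X * Y) * (X * Y)) := (distX z.1.1 z.2.1 - distY z.1.2 z.2.2)%R.
pose F2 (z : (Y * Z) * (Y * Z)) := (distY z.1.1 z.2.1 - distZ z.1.2 z.2.2)%R.
pose F3 (z : (X * Z) * (X * Z)) := (distX z.1.1 z.2.1 - distZ z.1.2 z.2.2)%R.
have mF1 : measurable_fun setT F1 := mdiff mdX mdY.
have mF2 : measurable_fun setT F2 := mdiff mdY mdZ.
have mF3 : measurable_fun setT F3 := mdiff mdX mdZ.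
have N1 : 'N[tau \x tau]_p[(fun z => (F1 (z.1.1, z.2.1))%:E)] <=
    (coef e2 p)%:E * 'N[pi \x pi]_p[EFin \o F1].
  have := @Lnorm_product_le_scale _ _ _ _ _ _ _ tau pi fst id
    measurable_fst (@measurable_id _ _ setT) _ e20' (fun S mS => (tau1 S mS).1) p F1 p1 mF1.
  rewrite [(1 + e2)%R]addrC addrK => /le_trans; apply.
  by rewrite le_eqVlt; apply/orP; left; apply/eqP; congr (_ * _); apply: eq_Lnorm => -[].
have N2 : 'N[tau \x tau]_p[(fun z => (F2 (z.1.2, z.2.2))%:E)] <=
    (coef e1 p)%:E * 'N[sigma \x sigma]_p[EFin \o F2].
  have := @Lnorm_product_le_scale _ _ _ _ _ _ _ tau sigma snd id
    measurable_snd (@measurable_id _ _ setT) _ e10' (fun S mS => (tau2 S mS).1) p F2 p1 mF2.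
  rewrite [(1 + e1)%R]addrC addrK => /le_trans; apply.
  by rewrite le_eqVlt; apply/orP; left; apply/eqP; congr (_ * _); apply: eq_Lnorm => -[].
(* As [rho] is the image of [tau], the comparison constant is 1 and [coef 0 p] is 1. *)
have N3 : 'N[rho \x rho]_p[EFin \o F3] <=
    'N[tau \x tau]_p[(fun z => (F3 (ends z.1, ends z.2))%:E)].
  have := @Lnorm_product_le_scale _ _ _ _ _ _ _ rho tau id ends
    (@measurable_id _ _ setT) mends 1%R ler01.
  have tau_rho S : measurable S -> rho (id @^-1` S) <= 1%:E * tau (ends @^-1` S).
    by move=> mS; rewrite mul1e.
  move=> /(_ tau_rho p F3 p1 mF3); rewrite subrr coef0 mul1e; apply: le_trans.
  by rewrite le_eqVlt; apply/orP; left; apply/eqP; apply: eq_Lnorm => -[].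
apply: le_trans N3 _.
have mprod d1 (T1 : measurableType d1) (f : W -> T1) : measurable_fun setT f ->
    measurable_fun setT (fun z : W * W => (f z.1, f z.2)).
  move=> mf; apply: measurable_fun_pair.
  - exact: (measurableT_comp mf measurable_fst).
  - exact: (measurableT_comp mf measurable_snd).
(* All three norms now live on [W * W]. Absolute values make [f1 + delta + f2] a nonnegative
   majorant of [F3]. *)
pose f1 (z : W * W) := `|F1 (z.1.1, z.2.1)|%R.
pose f2 (z : W * W) := `|F2 (z.1.2, z.2.2)|%R.
have mf1 : measurable_fun setT f1.
  by apply: measurableT_comp => //; exact: (measurableT_comp mF1 (mprod _ _ _ measurable_fst)).
have mf2 : measurable_fun setT f2.
  by apply: measurableT_comp => //; exact: (measurableT_comp mF2 (mprod _ _ _ measurable_snd)).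
have mc : measurable_fun setT (cst delta : W * W -> R) by exact: measurable_cst.
have mg : measurable_fun setT (f1 \+ cst delta)%R by exact: measurable_funD.
apply: (@le_trans _ _ ('N[tau \x tau]_p[EFin \o ((f1 \+ cst delta) \+ f2)%R])).
  apply: (@ae_le_Lnorm _ _ _ (tau \x tau) p (fun z => F3 (ends z.1, ends z.2))) => //.
  - exact: (measurableT_comp mF3 (mprod _ _ _ mends)).
  - exact: measurable_funD.
  apply: filterS (ae_product tauP) => -[w w'] /= [[n [Pn1 Pn2]] [n' [Pn1' Pn2']]].
  have dn := Psmall _ _ _ Pn1 Pn2.
  have dn' := Psmall _ _ _ Pn1' Pn2'.
  have quad := dist_quadrilateral w.1.2 w.2.1 w'.1.2 w'.2.1 metY.
  rewrite /F3 /f1 /f2 /F1 /F2 /ends /=.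
  rewrite [leRHS]ger0_norm; last by rewrite !addr_ge0// ltW.
  set x := distX _ _ in quad *; set y := distY _ _ in quad *.
  set y' := distY w.2.1 _ in quad *; set z := distZ _ _.
  (* The outer differences are those of [pi] and [sigma]; the middle one is at most
     [delta / 2 + delta / 2] since each pair of [Y]-points shares a cell. *)
  have -> : (x - z = (x - y) + (y - y') + (y' - z))%R by ring.
  rewrite (le_trans (ler_normD _ _))// lerD2r (le_trans (ler_normD _ _))// lerD2l.
  rewrite (le_trans quad)//; lra.
(* Minkowski is used twice, first to split off [f2], then the constant, whose norm under a
   probability is [delta]. *)
apply: le_trans (eminkowski _ mg mf2 p1) _.
apply: leeD; last first.
  apply: le_trans N2.
  apply: (@ae_le_Lnorm _ _ _ (tau \x tau) p f2) => //.
    exact: (measurableT_comp mF2 (mprod _ _ _ measurable_snd)).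
  by apply: aeW => z; rewrite normr_id.
apply: le_trans (eminkowski _ mf1 mc p1) _.
apply: leeD; last by rewrite Lnorm_probability_cst// ltW.
apply: le_trans N1.
apply: (@ae_le_Lnorm _ _ _ (tau \x tau) p f1) => //.
  exact: (measurableT_comp mF1 (mprod _ _ _ measurable_fst)).
by apply: aeW => z; rewrite normr_id.
Qed.

End approximate_composition.

(** * Passage to the infimum *)

Lemma distortion_ge0 (R : realType) (dx dy : measure_display)
    (X : measurableType dx) (Y : measurableType dy)
    (distX : X -> X -> R) (distY : Y -> Y -> R) (p : \bar R)
    (pi : probability (X * Y)%type R) : 1 <= p ->
  0 <= distortion distX distY p pi.
Proof. by move=> p1; rewrite distortionE// Lnorm_ge0. Qed.

Lemma sPGW_ge0 (R : realType) (dx dy : measure_display)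
    (X : measurableType dx) (Y : measurableType dy) (e1 e2 : R) (p : \bar R)
    (distX : X -> X -> R) (distY : Y -> Y -> R)
    (muX : probability X R) (muY : probability Y R) : 1 <= p ->
  0 <= sPGW e1 e2 p distX distY muX muY.
Proof.
by move=> p1; apply: le_ereal_inf_tmp => _ [pi [_ ->]]; exact: distortion_ge0.
Qed.

Local Close Scope ereal_scope.

Theorem theorem3p10 (R : realType) (e1 e2 : R) (p : \bar R)
  (dx dy dz : measure_display)
  (X : measurableType dx) (Y : measurableType dy) (Z : measurableType dz)
  (distX : X -> X -> R) (distY : Y -> Y -> R) (distZ : Z -> Z -> R)
  (muX : probability X R) (muY : probability Y R) (muZ : probability Z R) :
  0 <= e1 -> 0 <= e2 -> (1%E <= p)%E ->
  compact_pmm_space distX -> compact_pmm_space distY -> compact_pmm_space distZ ->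
  (sPGW (e1 + e2 + e1 * e2) (e1 + e2 + e1 * e2) p distX distZ muX muZ <=
     (coef e2 p)%:E * sPGW e1 e2 p distX distY muX muY
     + (coef e1 p)%:E * sPGW e1 e2 p distY distZ muY muZ)%E.
Proof.
move=> e10 e20 p1 cX cY cZ.
have c1 := coef_gt0 p e10; have c2 := coef_gt0 p e20.
have I1 := sPGW_ge0 e1 e2 distX distY muX muY p1.
have I2 := sPGW_ge0 e1 e2 distY distZ muY muZ p1.
set s1 := sPGW e1 e2 p distX distY muX muY in I1 *.
set s2 := sPGW e1 e2 p distY distZ muY muZ in I2 *.
have neqNy (c : R) (x : \bar R) : 0 <= c -> (0 <= x)%E -> (c%:E * x != -oo)%E.
  by move=> c0 x0; rewrite gt_eqF// (lt_le_trans ltNy0)// mule_ge0// lee_fin.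
(* An infinite value makes the right side infinite, as the coefficients are positive and the other
   term is not [-oo]. Otherwise both values are finite and near-optimal plans can be chosen. *)
have [s1y|s1fin] := eqVneq s1 +oo%E.
  by rewrite s1y gt0_muley ?lte_fin// addye ?leey// neqNy// ltW.
have [s2y|s2fin] := eqVneq s2 +oo%E.
  by rewrite s2y gt0_muley ?lte_fin// addey ?leey// neqNy// ltW.
have {}s1fin : s1 \is a fin_num by rewrite ge0_fin_numE// ltey.
have {}s2fin : s2 \is a fin_num by rewrite ge0_fin_numE// ltey.
apply/lee_addgt0Pr => e e0.
(* The errors are [h] times [coef e2 p] and [h] times [coef e1 p] from the two near-optimal plans,
   and [h] from the gluing; they sum to [e]. *)
pose h := e / (coef e1 p + coef e2 p + 1).
have K0 : 0 < coef e1 p + coef e2 p + 1 by rewrite !addr_gt0.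
have h0 : 0 < h by rewrite divr_gt0.
have [_ [pi [Spi ->]] pilt] := lb_ereal_inf_adherent h0 s1fin.
have [_ [sg [Ssg ->]] sglt] := lb_ereal_inf_adherent h0 s2fin.
have [rho [Srho rhole]] :=
  approximate_composition e10 e20 p1 cX cY cZ Spi Ssg h0.
apply: (@le_trans _ _ (distortion distX distZ p rho)).
  by apply: ereal_inf_lbound; exists rho.
apply: (le_trans rhole).
have le1 : ((coef e2 p)%:E * distortion distX distY p pi <=
    (coef e2 p)%:E * (s1 + h%:E))%E.
  by rewrite lee_wpmul2l ?lee_fin ?coef_ge0// ltW.
have le2 : ((coef e1 p)%:E * distortion distY distZ p sg <=
    (coef e1 p)%:E * (s2 + h%:E))%E.
  by rewrite lee_wpmul2l ?lee_fin ?coef_ge0// ltW.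
apply: (le_trans (leeD (leeD le1 (lexx _)) le2)).
rewrite -(fineK s1fin) -(fineK s2fin) -!EFinD lee_fin.
rewrite le_eqVlt; apply/orP; left; apply/eqP.
have -> : e = h * (coef e1 p + coef e2 p + 1) by rewrite /h divfK// gt_eqF.
ring.
Qed.
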